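(* Let $\{V_j\}_1^r=\{\mathbb{R}^{N_1},\mathbb{R}^{N_2},\dots,\mathbb{R}^{N_r}\}$ be an orthogonal partial flag in $\mathbb{R}^N$ with $\dim V_j=N_j$, defining a partition $\pi=(N_1,\dots,N_r)$ of $N=\sum_{j=1}^r N_j$, and suppose there are $q$ different values $n_1,\dots,n_q$ in the sequence $N_1,\dots,N_r$. Then the normalizer $\mathcal{N}(\{V_j\}_1^r)$ in $O(N)$ contains the orthogonal Borel subgroup $O(N_1)\times\dots\times O(N_r)$ and all permutations $\sigma_\pi\in\mathfrak{S}_\pi=\mathfrak{S}(\phi_\pi(n_1))\times\mathfrak{S}(\phi_\pi(n_2))\times\dots\times\mathfrak{S}(\phi_\pi(n_q))$. Moreover, the normalizer is generated by these maps, and consequently the Weyl group of $\{V_j\}_1^r$ is the product of $q$ permutation groups $$\mathcal{W}(\{V_j\}_1^r)=\mathfrak{S}_\pi=\mathfrak{S}(\phi_\pi(n_1))\times\dots\times\mathfrak{S}(\phi_\pi(n_q)).$$ Consequently, the Weyl group $\mathcal{W}(\{V_j\}_1^r)$ is of order $\psi_\pi(n_1)!\,\psi_\pi(n_2)!\cdots\psi_\pi(n_q)!=\psi_\pi(1)!\,\psi_\pi(2)!\cdots\psi_\pi(N)!$, and it contains an element of order $2$ provided it is not the trivial group.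
   Context: An orthogonal partial flag of length $r$ is an orthogonal decomposition $\mathbb{R}^N=\bigoplus_{j=1}^r V_j$ into nonzero subspaces. Its normalizer $\mathcal{N}(\{V_j\}_1^r)$ in $O(N)$ is the set of all $g\in O(N)$ mapping the family $\{V_j\}_1^r$ into itself (i.e. each $gV_j$ is some $V_{\sigma(j)}$); its Weyl group $\mathcal{W}(\{V_j\}_1^r)$ is the quotient of the normalizer by $O(V_1)\times\dots\times O(V_r)$. For $1\le n\le N$: $\phi_\pi(n)=\{1\le j\le r: N_j=n\}$, $\psi_\pi(n)=|\phi_\pi(n)|$, $0!=1$. $\mathfrak{S}(A)$ is the permutation group of a finite set $A$, and $\mathfrak{S}_\pi\subset\mathfrak{S}(r)$ is the group of permutations $\sigma$ of $\{1,\dots,r\}$ with $N_{\sigma(j)}=N_j$ for all $j$. A permutation $\sigma\in\mathfrak{S}_\pi$ is regarded as the orthogonal map $g_\sigma\in O(N)$, $g_\sigma(e^j_i)=e^{\sigma(j)}_i$, where $\{e^j_i\}_{i=1}^{N_j}$ is a fixed orthonormal basis of $V_j$ for each $j$. *)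

(* Defs.v *)
From HB Require Import structures.
From mathcomp Require Import all_boot all_order all_algebra all_fingroup.
From mathcomp Require Import boolp reals.

Set Implicit Arguments.
Unset Strict Implicit.
Unset Printing Implicit Defensive.

Import Order.TTheory GRing.Theory Num.Theory.
Local Open Scope ring_scope.
Local Open Scope quotient_scope.

(* Vectors of R^N are row vectors and matrices act on them from the right,    *)
(* u |-> u *m g, so that products in O(N) compose left to right, just like    *)
(* products of permutations, (s * t)%g i = t (s i).                           *)

Section OrthogonalGroup.
Variables (R : realType) (N : nat).

Definition dotv (u v : 'rV[R]_N) : R := (u *m v^T) 0 0.

Definition is_orthogonal_mx : pred 'M[R]_N := [pred g | g *m g^T == 1%:M].

Record orthogonal_group :=
  OrthogonalMx { omx :> 'M[R]_N; omxP : is_orthogonal_mx omx }.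

HB.instance Definition _ := [isSub for omx].
HB.instance Definition _ := [Choice of orthogonal_group by <:].

Fact orth1_subproof : is_orthogonal_mx 1%:M.
Proof. by rewrite /is_orthogonal_mx /= trmx1 mulmx1. Qed.

Fact orthM_subproof (g h : orthogonal_group) : is_orthogonal_mx (g *m h).
Proof.
rewrite /is_orthogonal_mx /= trmx_mul mulmxA -(mulmxA _ _ h^T).
by rewrite (eqP (omxP h)) mulmx1 (eqP (omxP g)).
Qed.

Fact orthV_subproof (g : orthogonal_group) : is_orthogonal_mx (omx g)^T.
Proof. by rewrite /is_orthogonal_mx /= trmxK; apply/eqP/mulmx1C/eqP/omxP. Qed.

Definition orth1 := OrthogonalMx orth1_subproof.
Definition orthM g h := OrthogonalMx (orthM_subproof g h).
Definition orthV g := OrthogonalMx (orthV_subproof g).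

Fact orthMA : associative orthM.
Proof. by move=> f g h; apply/val_inj; rewrite /= mulmxA. Qed.
Fact orth1M : left_id orth1 orthM.
Proof. by move=> g; apply/val_inj; rewrite /= mul1mx. Qed.
Fact orthM1 : right_id orth1 orthM.
Proof. by move=> g; apply/val_inj; rewrite /= mulmx1. Qed.
Fact orthVM : left_inverse orth1 orthV orthM.
Proof. by move=> g; apply/val_inj/mulmx1C/eqP/omxP. Qed.
Fact orthMV : right_inverse orth1 orthV orthM.
Proof. by move=> g; apply/val_inj/eqP/omxP. Qed.

HB.instance Definition _ :=
  isGroup.Build orthogonal_group orthMA orth1M orthM1 orthVM orthMV.

Definition subspace_image (g : orthogonal_group) (V : {vspace 'rV[R]_N}) :
  {vspace 'rV[R]_N} := (linfun (mulmxr (omx g)) @: V)%VS.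

(* O(V), seen in O(N): its elements are extended by the identity on the       *)
(* orthogonal complement of V.                                                *)
Definition orthogonal_on (V : {vspace 'rV[R]_N}) (g : orthogonal_group) : Prop :=
  subspace_image g V = V /\
  forall u, (forall v, v \in V -> dotv u v = 0) -> u *m g = u.

Definition orthonormal_basis (V : {vspace 'rV[R]_N}) (b : seq 'rV[R]_N) : Prop :=
  basis_of V b /\
  {in gtn (size b) &, forall i k, dotv b`_i b`_k = (i == k)%:R}.

Lemma dotvC u v : dotv u v = dotv v u.
Proof. by rewrite /dotv -[u in LHS]trmxK -trmx_mul mxE. Qed.

Lemma dotv_sumr u I (s : seq I) P (F : I -> 'rV[R]_N) :
  dotv u (\sum_(i <- s | P i) F i) = \sum_(i <- s | P i) dotv u (F i).
Proof. by rewrite /dotv linear_sum mulmx_sumr summxE. Qed.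

Lemma dotv_eq0 u : dotv u u = 0 -> u = 0.
Proof.
rewrite /dotv mxE => /eqP; rewrite psumr_eq0 => [/allP u0 | i _]; last first.
  by rewrite mxE -expr2 sqr_ge0.
apply/rowP=> i; have := u0 i (mem_index_enum _).
by rewrite !mxE mulf_eq0 orbb => /eqP.
Qed.

Lemma mem_subspace_image g (V : {vspace 'rV[R]_N}) u : u \in V -> u *m omx g \in subspace_image g V.
Proof. by move=> uV; have /= := memv_img (linfun (mulmxr (omx g))) uV; rewrite lfunE. Qed.

Lemma subspace_imageP g (V : {vspace 'rV[R]_N}) u :
  reflect (exists2 v, v \in V & u = v *m omx g) (u \in subspace_image g V).
Proof.
apply: (iffP memv_imgP) => [] [v vV ->]; exists v => //; by rewrite lfunE.
Qed.

Lemma subspace_image1 V : subspace_image 1%g V = V.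
Proof.
apply/vspaceP=> u; apply/subspace_imageP/idP => [[v vV ->]|uV].
  by rewrite /= mulmx1.
by exists u; rewrite //= mulmx1.
Qed.

Lemma subspace_imageM g h V :
  subspace_image (g * h)%g V = subspace_image h (subspace_image g V).
Proof.
apply/vspaceP=> u; apply/subspace_imageP/subspace_imageP => [[v vV ->]|[w]].
  by exists (v *m omx g); rewrite ?mem_subspace_image //= mulmxA.
by case/subspace_imageP=> v vV -> ->; exists v; rewrite //= mulmxA.
Qed.

Lemma subspace_imageK g V : subspace_image g^-1%g (subspace_image g V) = V.
Proof. by rewrite -subspace_imageM mulgV subspace_image1. Qed.

Lemma subspace_image_inj g : injective (subspace_image g).
Proof. exact: can_inj (subspace_imageK g). Qed.

Lemma dim_subspace_image g V : \dim (subspace_image g V) = \dim V.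
Proof.
apply/limg_dim_eq/eqP; rewrite -subv0; apply/subvP => u.
rewrite memv_cap memv_ker lfunE /= => /andP[_ /eqP ug0].
rewrite memv0 -[u]mulmx1 -(eqP (omxP g)).
by rewrite mulmxA ug0 mul0mx.
Qed.

End OrthogonalGroup.

Section Generated.
Variable G : groupType.

Definition generated_by (A : G -> Prop) (g : G) : Prop :=
  forall H : {pred G}, group_closed H -> (forall x, A x -> x \in H) -> g \in H.

End Generated.

Section PartialFlag.
Variables (R : realType) (N r : nat).

(* The sum is automatically direct, the summands being pairwise orthogonal.   *)
Record partial_flag := PartialFlag {
  flag_space :> 'I_r -> {vspace 'rV[R]_N};
  flag_neq0 : forall j, flag_space j != 0%VS;
  flag_orth : forall j k, j != k -> forall u v,
    u \in flag_space j -> v \in flag_space k -> dotv u v = 0;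
  flag_sum : (\sum_j flag_space j)%VS = fullv }.

Variable V : partial_flag.
Local Notation O := (orthogonal_group R N).

Definition flag_normalizer : {pred O} :=
  [pred g : O | [forall j, [exists k, subspace_image g (V j) == V k]]].

(* The orthogonal Borel subgroup O(V_1) x ... x O(V_r) of O(N).               *)
Definition flag_borel : {pred O} :=
  [pred g : O | `[< exists2 h : 'I_r -> O,
    forall j, orthogonal_on (V j) (h j) & g = (\prod_(j < r) h j)%g >]].

Lemma flag_decomp u : exists2 w : 'I_r -> 'rV[R]_N,
  forall j, w j \in V j & u = \sum_j w j.
Proof.
have : u \in (\sum_j V j)%VS by rewrite flag_sum memvf.
by case/memv_sumP => w wV ->; exists w => // j; apply: wV.
Qed.

Lemma flag_ext (A B : 'M[R]_N) :
  (forall j u, u \in V j -> u *m A = u *m B) -> A = B.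
Proof.
move=> AB; apply/row_matrixP => i; rewrite !rowE.
have [w wV ->] := flag_decomp (delta_mx 0 i).
by rewrite !mulmx_suml; apply: eq_bigr => j _; apply: AB.
Qed.

Lemma flag_dotP j u : (forall k v, k != j -> v \in V k -> dotv u v = 0) ->
  u \in V j.
Proof.
have [w wV -> H] := flag_decomp u.
rewrite (bigD1 j) //= big1 ?addr0 // => k kj.
apply: dotv_eq0; rewrite -(H k _ kj (wV k)).
rewrite [RHS]dotvC dotv_sumr (bigD1 k) //= [X in _ = _ + X]big1 ?addr0 // => i ik.
by apply: (@flag_orth V k i) => //; rewrite eq_sym.
Qed.

Lemma flag_inj : injective V.
Proof.
move=> j k Vjk; apply/eqP/negPn/negP => jk.
case/negP: (flag_neq0 V j); rewrite -subv0; apply/subvP=> u uV.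
rewrite memv0; apply/eqP/dotv_eq0/(@flag_orth V j k jk) => //.
by move: uV; rewrite Vjk.
Qed.

Lemma flag_normalizerP g :
  reflect (forall j, exists k, subspace_image g (V j) = V k)
          (g \in flag_normalizer).
Proof.
apply: (iffP forallP) => H j.
  by have /existsP[k /eqP] := H j; exists k.
by have [k] := H j => Hk; apply/existsP; exists k; apply/eqP.
Qed.

Lemma orthogonal_on_flag j k h :
  orthogonal_on (V j) h -> subspace_image h (V k) = V k.
Proof.
case=> hj hfix; have [->//|kj] := eqVneq k j.
have fixk u : u \in V k -> u *m omx h = u.
  by move=> uV; apply: hfix => v vV; apply: (@flag_orth V k j kj).
apply/vspaceP=> u; apply/subspace_imageP/idP => [[v vV ->]|uV].
  by rewrite fixk.
by exists u; rewrite ?fixk.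
Qed.

Lemma subspace_image_prod I (s : seq I) (h : I -> O) (W : {vspace 'rV[R]_N}) :
  (forall i, subspace_image (h i) W = W) ->
  subspace_image (\prod_(i <- s) h i)%g W = W.
Proof.
move=> H; elim: s => [|i s IH]; first by rewrite big_nil subspace_image1.
by rewrite big_cons subspace_imageM H.
Qed.


Lemma flag_dot_ext (x y : 'rV[R]_N) :
  (forall j v, v \in V j -> dotv x v = dotv y v) -> x = y.
Proof.
move=> xy; apply/eqP; rewrite -subr_eq0; apply/eqP/dotv_eq0.
have [w wV {2}->] := flag_decomp (x - y).
rewrite dotv_sumr big1 // => j _.
have -> : dotv (x - y) (w j) = dotv x (w j) - dotv y (w j).
  by rewrite /dotv mulmxBl mxE [X in _ + X]mxE.
by rewrite (xy j) ?subrr.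
Qed.

Lemma flag_projs : exists P : 'I_r -> 'M[R]_N, forall j u,
  [/\ u *m P j \in V j, u \in V j -> u *m P j = u &
      forall k, k != j -> u \in V k -> u *m P j = 0].
Proof.
have /choice[w wP] i : exists w : 'I_r -> 'rV[R]_N,
    (forall j, w j \in V j) /\ delta_mx 0 i = \sum_j w j.
  by have [w] := flag_decomp (delta_mx 0 i); exists w.
pose P j : 'M[R]_N := \matrix_i w i j.
have uP u j : u *m P j \in V j.
  rewrite mulmx_sum_row; apply: memv_suml => i _.
  by rewrite /P rowK memvZ //; case: (wP i).
have sumP (u : 'rV_N) : u = \sum_j u *m P j.
  rewrite -mulmx_sumr -[LHS]mulmx1; congr (_ *m _).
  apply/row_matrixP => i; rewrite rowE mulmx1 (proj2 (wP i)) linear_sum.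
  by apply: eq_bigr => j _; rewrite /= rowK.
have P0 j k u : k != j -> u \in V k -> u *m P j = 0.
  move=> kj uV; apply: dotv_eq0.
  have : dotv (u *m P j) u = 0 by apply: (@flag_orth V j k); rewrite // eq_sym.
  rewrite {2}[u]sumP dotv_sumr (bigD1 j) //= big1 ?addr0 // => i ij.
  by apply: (@flag_orth V j i); rewrite // eq_sym.
exists P => j u; split=> // [uV|k]; last exact: P0.
rewrite [RHS]sumP (bigD1 j) //= big1 ?addr0 // => i ij.
by apply: (P0 i j); rewrite // eq_sym.
Qed.

Lemma dotv_orth (g : O) u v : dotv (u *m g) (v *m g) = dotv u v.
Proof.
by rewrite /dotv trmx_mul mulmxA -(mulmxA u) (eqP (omxP g)) mulmx1.
Qed.

Lemma flag_block (g : O) j : (forall k, subspace_image g (V k) = V k) ->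
  exists2 h : O, orthogonal_on (V j) h &
    (forall u, u \in V j -> u *m h = u *m g) /\
    (forall k u, k != j -> u \in V k -> u *m h = u).
Proof.
move=> gV; have [P PP] := flag_projs.
have gVj u : u \in V j -> u *m g \in V j by rewrite -{2}(gV j); apply: mem_subspace_image.
pose h : 'M[R]_N := P j *m g + (1%:M - P j).
have hj u : u \in V j -> u *m h = u *m g.
  move=> uV; have [_ /(_ uV) uP _] := PP j u.
  by rewrite mulmxDr mulmxBr mulmx1 mulmxA uP subrr addr0.
have hk k u : k != j -> u \in V k -> u *m h = u.
  move=> kj uV; have [_ _ /(_ k kj uV) uP] := PP j u.
  by rewrite mulmxDr mulmxBr mulmx1 mulmxA uP mul0mx subr0 add0r.
have hO : is_orthogonal_mx h.
  apply/eqP/flag_ext => k u uV; apply: (@flag_dot_ext) => l v vV.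
  rewrite mulmx1.
  have -> : dotv (u *m (h *m h^T)) v = dotv (u *m h) (v *m h).
    by rewrite /dotv trmx_mul !mulmxA.
  have [kj|kj] := eqVneq k j; have [lj|lj] := eqVneq l j.
  - by rewrite kj in uV; rewrite lj in vV; rewrite !hj // dotv_orth.
  - rewrite kj in uV; rewrite hj // (hk l) //.
    rewrite (@flag_orth V j l) // 1?eq_sym ?gVj //.
    by rewrite (@flag_orth V j l) // 1?eq_sym.
  - rewrite lj in vV; rewrite (hk k) // hj //.
    rewrite (@flag_orth V k j) // ?gVj //.
    by rewrite (@flag_orth V k j).
  - by rewrite (hk k) // (hk l).
exists (OrthogonalMx hO) => //; split=> /=.
  apply/vspaceP=> u; apply/subspace_imageP/idP => [[v vV ->]|].
    by rewrite /= hj // gVj.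
  rewrite -{1}(gV j) => /subspace_imageP[v vV ->]; exists v => //=.
  by rewrite hj.
move=> u uV; have [w wV uE] := flag_decomp u.
have w0 : w j = 0.
  apply: dotv_eq0; rewrite -[RHS](uV _ (wV j)) uE [RHS]dotvC dotv_sumr.
  rewrite (bigD1 j) //= [X in _ + X]big1 ?addr0 // => k kj.
  by apply: (@flag_orth V j k); rewrite // eq_sym.
rewrite uE mulmx_suml; apply: eq_bigr => k _; have [->|kj] := eqVneq k j.
  by rewrite w0 mul0mx.
exact: (hk k).
Qed.

Lemma flag_borelP g :
  reflect (forall j, subspace_image g (V j) = V j) (g \in flag_borel).
Proof.
apply: (iffP (asboolP _)) => [[h hV ->] k | gV].
  by apply: subspace_image_prod => j; apply: orthogonal_on_flag (hV j).
have /choice[h hP] j : exists h : O, orthogonal_on (V j) h /\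
    (forall u, u \in V j -> u *m h = u *m g) /\
    (forall k u, k != j -> u \in V k -> u *m h = u).
  by have [h] := flag_block j gV; exists h.
exists h => [j|]; first by case: (hP j).
apply/val_inj/flag_ext => k u uV.
have gVk v : v \in V k -> v *m g \in V k.
  by rewrite -{2}(gV k); apply: mem_subspace_image.
have fixP (s : seq 'I_r) v : k \notin s -> v \in V k ->
    v *m omx (\prod_(j <- s) h j)%g = v.
  elim: s => [|j s IH] in v *; first by rewrite big_nil /= mulmx1.
  rewrite inE negb_or big_cons /= mulmxA => /andP[kj ks] vV.
  by have [_ [_ hk]] := hP j; rewrite (hk k) ?IH.
suff : forall s : seq 'I_r, uniq s -> k \in s ->
    u *m omx (\prod_(j <- s) h j)%g = u *m g.
  by move=> /(_ (index_enum 'I_r)) ->; rewrite ?index_enum_uniq ?mem_index_enum.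
elim=> //= j s IH /andP[js us]; rewrite inE big_cons /= mulmxA.
have [kj|kj /= ks] := eqVneq k j.
  by move=> _; have [_ [hj _]] := hP j; rewrite hj -?kj // fixP ?gVk // kj.
by have [_ [_ hk]] := hP j; rewrite (hk k) ?IH.
Qed.


Lemma flag_borel_normalizer g : g \in flag_borel -> g \in flag_normalizer.
Proof. by move=> /flag_borelP gV; apply/flag_normalizerP => j; exists j. Qed.

Fact flag_borel_closed : group_closed flag_borel.
Proof.
split=> [|g h /flag_borelP gV /flag_borelP hV]; apply/flag_borelP => j.
  exact: subspace_image1.
by rewrite subspace_imageM gV -{1}(hV j) subspace_imageK.
Qed.

Fact flag_normalizer_closed : group_closed flag_normalizer.
Proof.
split=> [|g h /flag_normalizerP gV /flag_normalizerP hV].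
  by apply/flag_normalizerP => j; exists j; apply: subspace_image1.
have /choice[s sP] := hV.
have s_inj : injective s.
  move=> i j sij; apply: flag_inj; apply: (@subspace_image_inj _ _ h).
  by rewrite !sP sij.
apply/flag_normalizerP => j; have [k gjk] := gV j.
exists (invF s_inj k); rewrite subspace_imageM gjk -{1}(f_invF s_inj k) -sP.
exact: subspace_imageK.
Qed.

Fact flag_borel_normal g h :
  g \in flag_borel -> h \in flag_normalizer -> (g ^ h)%g \in flag_borel.
Proof.
move=> /flag_borelP gV hN; apply/flag_borelP => j.
have : h^-1%g \in flag_normalizer.
  by apply: (group_closedV flag_normalizer_closed).
move/flag_normalizerP => /(_ j)[k hjk].
rewrite conjgE !subspace_imageM hjk gV -hjk -subspace_imageM mulVg.
exact: subspace_image1.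
Qed.

HB.instance Definition _ := isMulClosed.Build O flag_normalizer
  (group_closedM flag_normalizer_closed).
HB.instance Definition _ := isMul1Closed.Build O flag_normalizer
  (proj1 flag_normalizer_closed).
HB.instance Definition _ := isInvClosed.Build O flag_normalizer
  (group_closedV flag_normalizer_closed).

Record normalizer_group := NormalizerElt {
  normalizer_val :> O; normalizer_valP : normalizer_val \in flag_normalizer }.

HB.instance Definition _ := [isSub for normalizer_val].
HB.instance Definition _ := [Choice of normalizer_group by <:].
HB.instance Definition _ :=
  SubChoice_isSubGroup.Build O flag_normalizer normalizer_group
    flag_normalizer_closed.

(* The Weyl group: the quotient of the normalizer by the normal subgroup      *)
(* O(V_1) x ... x O(V_r).                                                     *)
Definition borel_eq (x y : normalizer_group) : bool :=
  (val x * (val y)^-1)%g \in flag_borel.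

Fact borel_eq_refl : reflexive borel_eq.
Proof. by move=> x; rewrite /borel_eq mulgV; case: flag_borel_closed. Qed.

Fact borel_eq_sym : symmetric borel_eq.
Proof.
have bV x : x \in flag_borel -> x^-1%g \in flag_borel.
  exact: (group_closedV flag_borel_closed).
by move=> x y; apply/idP/idP => /bV; rewrite invgF.
Qed.

Fact borel_eq_trans : transitive borel_eq.
Proof.
move=> y x z xy yz; rewrite /borel_eq -(mulgK (val y)^-1%g (val x)) invgK -mulgA.
exact: (group_closedM flag_borel_closed).
Qed.

Canonical borel_eq_rel :=
  EquivRel borel_eq borel_eq_refl borel_eq_sym borel_eq_trans.

Definition weyl_group : Type := {eq_quot borel_eq}.

HB.instance Definition _ := Choice.on weyl_group.
HB.instance Definition _ := EqQuotient.on weyl_group.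

Definition weyl_class (x : normalizer_group) : weyl_group := \pi_weyl_group x.

Definition weyl1 : weyl_group := weyl_class 1%g.
Local Notation quot_repr := generic_quotient.repr.

Definition weylM (x y : weyl_group) : weyl_group :=
  weyl_class (quot_repr x * quot_repr y)%g.
Definition weylV (x : weyl_group) : weyl_group :=
  weyl_class (quot_repr x)^-1%g.

Lemma weylE (x y : normalizer_group) :
  reflect (weyl_class x = weyl_class y)
          ((val x * (val y)^-1)%g \in flag_borel).
Proof.
exact: (@eqquotP _ borel_eq weyl_group x y).
Qed.

Lemma weyl_classK x : weyl_class (quot_repr x) = x.
Proof. exact: reprK. Qed.

Lemma weyl_class_surj w : exists x, w = weyl_class x.
Proof. by exists (quot_repr w); rewrite weyl_classK. Qed.

Lemma weyl_classM (x y : normalizer_group) :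
  weyl_class (x * y)%g = weylM (weyl_class x) (weyl_class y).
Proof.
rewrite /weylM; set a := quot_repr _; set b := quot_repr _.
have /weylE xa : weyl_class x = weyl_class a by rewrite weyl_classK.
have /weylE yb : weyl_class y = weyl_class b by rewrite weyl_classK.
apply/weylE; rewrite !gmulfM /= invgM.
have aN : (val a)^-1%g \in flag_normalizer.
  exact: (group_closedV flag_normalizer_closed) (valP a).
have := flag_borel_normal yb aN; rewrite conjgE invgK => yba.
have := group_closedM flag_borel_closed xa yba.
by rewrite !mulgA mulgVK.
Qed.

Lemma weyl_classV (x : normalizer_group) :
  weyl_class x^-1%g = weylV (weyl_class x).
Proof.
rewrite /weylV; set a := quot_repr _.
have /weylE xa : weyl_class a = weyl_class x by rewrite weyl_classK.
apply/weylE; rewrite !gmulfV /= invgK.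
have := flag_borel_normal xa (valP x).
by rewrite conjgE /= mulgVK.
Qed.

Fact weylMA : associative weylM.
Proof.
move=> x y z; have [x' ->] := weyl_class_surj x.
have [y' ->] := weyl_class_surj y; have [z' ->] := weyl_class_surj z.
rewrite -(weyl_classM y' z') -(weyl_classM x' y') -(weyl_classM x').
by rewrite -weyl_classM mulgA.
Qed.
Fact weyl1M : left_id weyl1 weylM.
Proof.
by move=> x; have [y ->] := weyl_class_surj x; rewrite -weyl_classM mul1g.
Qed.
Fact weylM1 : right_id weyl1 weylM.
Proof.
by move=> x; have [y ->] := weyl_class_surj x; rewrite -weyl_classM mulg1.
Qed.
Fact weylVM : left_inverse weyl1 weylV weylM.
Proof.
move=> x; have [y ->] := weyl_class_surj x.
by rewrite -weyl_classV -weyl_classM mulVg.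
Qed.
Fact weylMV : right_inverse weyl1 weylV weylM.
Proof.
move=> x; have [y ->] := weyl_class_surj x.
by rewrite -weyl_classV -weyl_classM mulgV.
Qed.

HB.instance Definition _ :=
  isGroup.Build weyl_group weylMA weyl1M weylM1 weylVM weylMV.
HB.instance Definition _ :=
  isMultiplicative.Build normalizer_group weyl_group weyl_class weyl_classM.

End PartialFlag.

Section Partition.
Variables (r : nat) (p : 'I_r -> nat).

Definition phi (n : nat) : {set 'I_r} := [set j | p j == n].
Definition psi (n : nat) : nat := #|phi n|.

Definition perm_partition : {set {perm 'I_r}} :=
  [set s : {perm 'I_r} | [forall j, p (s j) == p j]].

Fact perm_partition_group_set : group_set perm_partition.
Proof.
apply/group_setP; split=> [|s t].
  by rewrite inE; apply/forallP => j; rewrite perm1.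
rewrite !inE => /forallP sP /forallP tP; apply/forallP => j.
by rewrite permM (eqP (tP _)).
Qed.

Canonical perm_partition_group := Group perm_partition_group_set.

End Partition.

(* Main.v *)
(* The permutations of the fixed frames act on the family {V_j} exactly as    *)
(* S_pi acts on the indices, while the Borel subgroup is the kernel of the    *)
(* action of the normalizer on that family. An element g of the normalizer    *)
(* permutes the V_j by some s, which preserves dimensions because g is        *)
(* injective; hence s lies in S_pi and g s^-1 in the Borel subgroup, so that  *)
(* s |-> [g_s] identifies S_pi with the Weyl group.                           *)

Require Import Defs.
From HB Require Import structures.
From mathcomp Require Import all_boot all_order all_algebra all_fingroup.
From mathcomp Require Import boolp classical_sets functions cardinality reals.

Set Implicit Arguments.
Unset Strict Implicit.
Unset Printing Implicit Defensive.

Import Order.TTheory GRing.Theory Num.Theory.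
Local Open Scope ring_scope.

(** The normalizer acts on the finite set of the [V j], with the Borel subgroup as kernel
    ([flag_borelP]). Only dimension-preserving permutations occur ([normalizer_perm]), and each of
    them does, because the frame maps [frame_perm] form a section of the action ([frame_perm_image],
    [frame_permM]). Thus g induces s exactly when g times the inverse of [frame_perm s] is Borel
    ([borel_frame_perm]); this yields both the generation of the normalizer and the isomorphism
    [frame_weyl_bij]. What remains concerns permutations only: the blocks of indices of equal
    dimension split [perm_partition p] into symmetric groups ([perm_partition_dprod]), hence the
    order, and a transposition inside a block is the element of order 2. *)

Section PermPartition.
Variables (r : nat) (p : 'I_r -> nat).

(** * Block decomposition of the permutations that preserve [p] *)

Lemma perm_partitionP (s : {perm 'I_r}) :
  reflect (forall j, p (s j) = p j) (s \in perm_partition p).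
Proof. by rewrite inE; apply: (iffP forallP) => sp j; apply/eqP. Qed.

Lemma perm_partitionE (s : {perm 'I_r}) :
  s \in perm_partition p -> forall j, p (s j) = p j.
Proof. by move/perm_partitionP. Qed.

Lemma Sym_phi_sub m : Sym (phi p m) \subset perm_partition p.
Proof.
apply/fintype.subsetP=> s; rewrite inE => sm; apply/perm_partitionP=> j.
have [jm|jm] := boolP (j \in phi p m); last by rewrite (out_perm sm).
have := perm_closed j sm; rewrite jm inE => /eqP ->.
by move: jm; rewrite inE => /eqP ->.
Qed.

(** Allowing any list [l] of distinct values, with the support confined to the blocks listed, makes
    induction on [l] possible. Disjoint supports give commutation and trivial intersection. *)
Lemma bigdprod_Sym_phi (l : seq nat) : uniq l ->
  \big[dprod/1%g]_(m <- l) Sym (phi p m) =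
    (perm_partition p :&: Sym [set j | p j \in l]%SET)%SET.
Proof.
elim: l => [|m l IH] /=.
  move=> _; rewrite big_nil; apply/setP=> s; rewrite finset.in_set1 finset.in_setI [s \in Sym _]inE.
  apply/eqP/andP=> [->|[_ s0]]; first by rewrite group1 perm_on1.
  by apply: (perm_on_id s0); rewrite (eq_card0) // => j; rewrite !inE.
case/andP=> ml /IH {}IH; rewrite big_cons IH.
have dis : [disjoint phi p m & [set j | p j \in l]%SET].
  apply/pred0P=> j /=; rewrite !inE; apply/negbTE/negP=> /andP[/eqP ->].
  by rewrite (negbTE ml).
rewrite dprodE.
- apply/eqP; rewrite finset.eqEsubset; apply/andP; split; apply/fintype.subsetP=> s.
    case/mulsgP=> a b aS; rewrite finset.in_setI => /andP[bp bS] ->.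
    rewrite finset.in_setI groupM ?(fintype.subsetP (Sym_phi_sub m) _ aS) //=.
    move: aS bS; rewrite !inE => aS bS; apply: perm_onM.
      by apply: fintype.subset_trans aS _; apply/fintype.subsetP=> j; rewrite !inE => ->.
    apply: fintype.subset_trans bS _; apply/fintype.subsetP=> j.
    by rewrite !inE => ->; rewrite orbT.
  rewrite finset.in_setI => /andP[sp]; rewrite [s \in Sym _]inE => sS.
  have sN : s \in 'N(phi p m | 'P)%g.
    by apply/astabsP=> j /=; rewrite !inE /= apermE (perm_partitionE sp).
  (* [s] stabilizes the block of [m], so it factors as its restriction [a] to that block times
     [a^-1 * s], which fixes the block pointwise. *)
  set a := restr_perm (phi p m) s.
  have aS : a \in Sym (phi p m) by rewrite inE restr_perm_on.
  apply/mulsgP; exists a (a^-1 * s)%g => //; last by rewrite mulKVg.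
  rewrite finset.in_setI groupM ?groupV ?(fintype.subsetP (Sym_phi_sub m) _ aS) //= inE.
  apply/fintype.subsetP=> j; rewrite !inE; apply: contraNT => jl.
  rewrite permM; have [jm|jm] := boolP (j \in phi p m).
    rewrite -{2}[j](permKV a); apply/eqP/esym/restr_permE => //.
    by rewrite (perm_closed _ (perm_onV (restr_perm_on _ _))).
  have aV : perm_on (phi p m) a^-1%g by apply/perm_onV/restr_perm_on.
  rewrite (out_perm aV jm) (out_perm sS) // !inE negb_or jl andbT.
  by move: jm; rewrite inE.
- apply/centsP=> a; rewrite finset.in_setI => /andP[_]; rewrite inE => aS b.
  by rewrite inE => bS; apply/esym; apply: perm_onC bS aS dis.
- apply/trivgP/fintype.subsetP=> a; rewrite !finset.in_setI => /and3P[+ _].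
  rewrite !inE => am al; apply/eqP/permP=> j; rewrite perm1.
  have [jm|jm] := boolP (j \in phi p m); last exact: out_perm am jm.
  by apply: (out_perm al); rewrite (disjointFr dis).
Qed.

Lemma perm_partition_dprod q (n : q.-tuple nat) :
  uniq n -> (forall m, m \in n <-> exists j, p j = m) ->
  \big[dprod/1%g]_(k < q) Sym (phi p (tnth n k)) = perm_partition p.
Proof.
move=> n_uniq nE.
rewrite -(big_tuple _ _ n xpredT (fun m => Sym (phi p m))) bigdprod_Sym_phi //.
(* Every index has its value in [n], so the support condition is vacuous. *)
apply/finset.setIidPl/fintype.subsetP=> s _; rewrite inE; apply/fintype.subsetP=> j _.
by rewrite inE; apply/nE; exists j.
Qed.

Lemma card_perm_partition q (n : q.-tuple nat) :
  uniq n -> (forall m, m \in n <-> exists j, p j = m) ->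
  #|perm_partition p| = (\prod_(k < q) (psi p (tnth n k))`!)%N.
Proof.
move=> n_uniq nE; rewrite -(bigdprod_card (perm_partition_dprod n_uniq nE)).
by apply: eq_bigr => k _; apply: card_Sym.
Qed.

(** A value that [p] does not take has an empty block and contributes 0! = 1. *)
Lemma prod_psi_fact N q (n : q.-tuple nat) :
  uniq n -> (forall m, m \in n <-> exists j, p j = m) ->
  (forall j, 0 < p j <= N)%N ->
  (\prod_(k < q) (psi p (tnth n k))`! = \prod_(1 <= m < N.+1) (psi p m)`!)%N.
Proof.
move=> n_uniq nE pN; rewrite -(big_tuple _ _ n xpredT (fun m => (psi p m)`!)).
rewrite [RHS](bigID (mem n)) /= [X in (_ * X)%N]big1 ?muln1 => [|m mn]; last first.
  rewrite /psi (eq_card0) // => j; rewrite !inE; apply/negP=> /eqP jm.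
  by case/negP: mn; apply/nE; exists j.
rewrite -[RHS]big_filter; apply/perm_big/uniq_perm; rewrite ?filter_uniq ?iota_uniq //.
move=> m; rewrite mem_filter mem_index_iota ltnS.
by apply/idP/andP=> [mn|[]//]; split=> //; have [j <-] := (nE m).1 mn.
Qed.

(** If [s] moves j, then j and [s j] lie in the same block, and their transposition preserves
    [p]. *)
Lemma perm_partition_involution (s : [subg perm_partition p]) : s != 1%g ->
  exists t : [subg perm_partition p], t != 1%g /\ (t ^+ 2)%g = 1%g.
Proof.
move=> s1; have [j sj] : exists j, sgval s j != j.
  apply/existsP; apply: contraNT s1 => /existsPn sfix.
  by apply/eqP/subg_inj/permP=> j; rewrite perm1; apply/eqP/negPn/sfix.
have tp : tperm j (sgval s j) \in perm_partition p.
  by apply/perm_partitionP=> k; case: tpermP => // ->; rewrite (perm_partitionE (subgP s)).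
exists (subg _ (tperm j (sgval s j))); split; last first.
  by apply: subg_inj; rewrite expgS expg1 /= subgK // tperm2.
apply: contra sj => /eqP/(congr1 sgval); rewrite /= subgK // => /permP/(_ j).
by rewrite tpermL perm1 => ->.
Qed.

End PermPartition.

Lemma card_eq_fintype (T : finType) (W : Type) (f : T -> W) :
  bijective f -> ([set: W]%classic #= `I_#|T|)%card.
Proof.
case=> g fK gK; apply/card_set_bijP.
exists (fun w => enum_rank (g w) : nat); split.
- by move=> w _ /=; apply: ltn_ord.
- by move=> v w _ _ /ord_inj/enum_rank_inj/(can_inj gK).
- move=> i /= iT; exists (f (enum_val (Ordinal iT))) => //.
  by rewrite fK enum_valK.
Qed.

(** * Orthogonal maps that permute the frames *)

Section FlagFrame.
Variables (R : realType) (N r : nat) (V : partial_flag R N r).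
Variables (p : 'I_r -> nat) (e : forall j : 'I_r, (p j).-tuple 'rV[R]_N).
Hypothesis he : forall j, orthonormal_basis (V j) (e j).

Lemma flag_dim_frame j : \dim (V j) = p j.
Proof. by rewrite (size_basis (he j).1). Qed.

Lemma frame_mem j i : (i < p j)%N -> (e j)`_i \in V j.
Proof.
by move=> ij; apply: (basis_mem (he j).1); rewrite mem_nth ?size_tuple.
Qed.

Lemma frame_dot j k i l : (i < p j)%N -> (l < p k)%N ->
  dotv (e j)`_i (e k)`_l = ((j == k) && (i == l))%:R.
Proof.
move=> ij lk; have [jk|jk] /= := eqVneq j k; last first.
  by apply: (flag_orth jk); apply: frame_mem.
by rewrite -jk in lk *; apply: (he j).2; rewrite inE /= size_tuple.
Qed.

Lemma frame_decomp j u : u \in V j ->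
  exists c : 'I_(p j) -> R, u = \sum_i c i *: (e j)`_i.
Proof.
by move=> uV; exists (fun i => coord (e j) i u); apply: coord_basis uV; case: (he j).
Qed.

(** The frames together span the whole space, so matrices may be compared on frame vectors. *)
Lemma frame_ext (A B : 'M[R]_N) :
  (forall j i, (i < p j)%N -> (e j)`_i *m A = (e j)`_i *m B) -> A = B.
Proof.
move=> AB; apply: (@flag_ext _ _ _ V) => j u /frame_decomp[c ->].
by rewrite !mulmx_suml; apply: eq_bigr => i _; rewrite -!scalemxAl AB.
Qed.

(** A sum of rank-one matrices, meant to carry the frame of [V (a j)] to that of [V (b j)]. Keeping
    both [a] and [b] makes transposition a swap; numbering frame vectors by naturals avoids casts
    between ['I_(p j)] and ['I_(p (a j))]. *)
Definition frame_mx (a b : 'I_r -> 'I_r) : 'M[R]_N :=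
  \sum_j \sum_(i < p j) ((e (a j))`_i)^T *m (e (b j))`_i.

Lemma trmx_frame_mx a b : (frame_mx a b)^T = frame_mx b a.
Proof.
rewrite /frame_mx linear_sum; apply: eq_bigr => j _.
by rewrite linear_sum; apply: eq_bigr => i _; rewrite /= trmx_mul trmxK.
Qed.

Lemma frame_mxE a b j i : injective a -> (forall k, p (a k) = p k) ->
  (i < p j)%N -> (e (a j))`_i *m frame_mx a b = (e (b j))`_i.
Proof.
move=> a_inj ap ij.
(* By orthonormality, each rank-one term kills every frame vector except its own. *)
have E k (l : 'I_(p k)) : (e (a j))`_i *m (((e (a k))`_l)^T *m (e (b k))`_l) =
    ((j == k) && (i == l))%:R *: (e (b k))`_l.
  rewrite mulmxA [_ *m _^T]mx11_scalar mul_scalar_mx; congr (_ *: _).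
  by rewrite -(inj_eq a_inj); apply: frame_dot; rewrite ap.
rewrite mulmx_sumr (bigD1 j) //= [X in _ + X]big1 ?addr0 => [|k kj]; last first.
  by rewrite mulmx_sumr big1 // => l _; rewrite E eq_sym (negbTE kj) scale0r.
rewrite mulmx_sumr (bigD1 (Ordinal ij)) //= [X in _ + X]big1 ?addr0 => [|l li].
  by rewrite (E j (Ordinal ij)) !eqxx scale1r.
by rewrite E eqxx eq_sym [_ == _](negbTE li) scale0r.
Qed.

Fact frame_mx_orthogonal (s : {perm 'I_r}) :
  s \in perm_partition p -> is_orthogonal_mx (frame_mx id s).
Proof.
move=> /perm_partitionP sp; apply/eqP/frame_ext => j i ij.
(* The transpose [frame_mx s id] carries each frame vector back to where it came from. *)
rewrite trmx_frame_mx mulmxA mulmx1 (@frame_mxE id) //.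
by rewrite (@frame_mxE s id) //; apply: perm_inj.
Qed.

Definition frame_perm (s : [subg perm_partition p]) : orthogonal_group R N :=
  OrthogonalMx (frame_mx_orthogonal (subgP s)).

Lemma frame_permE s j i : (i < p j)%N ->
  (e j)`_i *m frame_perm s = (e (sgval s j))`_i.
Proof. exact: (@frame_mxE id). Qed.

Lemma frame_permM : {morph frame_perm : s t / (s * t)%g}.
Proof.
move=> s t; apply/val_inj/frame_ext => j i ij.
have sp := perm_partitionE (subgP s).
by rewrite /= mulmxA !(@frame_mxE id) ?sp // permM.
Qed.

Lemma frame_perm_image s j : subspace_image (frame_perm s) (V j) = V (sgval s j).
Proof.
have sp := perm_partitionE (subgP s).
(* Both sides have the same dimension, so one inclusion suffices. *)
apply/eqP; rewrite eqEdim dim_subspace_image !flag_dim_frame sp leqnn andbT.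
apply/subvP=> _ /subspace_imageP[v /frame_decomp[c ->] ->].
rewrite mulmx_suml memv_suml // => i _; rewrite -scalemxAl frame_permE // memvZ //.
by apply: frame_mem; rewrite sp.
Qed.

Lemma frame_perm_normalizer s : frame_perm s \in flag_normalizer V.
Proof.
by apply/flag_normalizerP=> j; exists (sgval s j); apply: frame_perm_image.
Qed.

(** * The normalizer and the Weyl group *)

Lemma normalizer_perm g : g \in flag_normalizer V ->
  exists s : [subg perm_partition p],
    forall j, subspace_image g (V j) = V (sgval s j).
Proof.
move=> /flag_normalizerP/choice[a aP].
(* Distinct indices carry distinct subspaces and g is invertible, so the index map is injective,
   hence a permutation. *)
have a_inj : injective a.
  move=> i j aij; apply: (flag_inj (V := V)); apply: (subspace_image_inj (g := g)).
  by rewrite !aP aij.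
have sp : perm a_inj \in perm_partition p.
  apply/perm_partitionP=> j.
  by rewrite permE -!flag_dim_frame -aP dim_subspace_image.
by exists (subg _ (perm a_inj)) => j; rewrite subgK // permE.
Qed.

Lemma borel_frame_perm g (s : [subg perm_partition p]) :
  (forall j, subspace_image g (V j) = V (sgval s j)) <->
  (g * (frame_perm s)^-1)%g \in flag_borel V.
Proof.
split=> [gs|/flag_borelP gs j].
  apply/flag_borelP=> j.
  by rewrite subspace_imageM gs -frame_perm_image subspace_imageK.
by rewrite -[g](mulgVK (frame_perm s)) subspace_imageM gs frame_perm_image.
Qed.

(** The factorization g = (g g_s^-1) g_s, with s the permutation induced by g, already suffices. *)
Lemma normalizer_generated g : g \in flag_normalizer V <->
  generated_by (fun x => x \in flag_borel V \/ exists s, x = frame_perm s) g.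
Proof.
split=> [gN H HG HA|]; last first.
  apply; first exact: flag_normalizer_closed.
  move=> x [/flag_borel_normalizer //|[s ->]]; exact: frame_perm_normalizer.
have [s /borel_frame_perm gs] := normalizer_perm gN.
rewrite -[g](mulgVK (frame_perm s)); apply: (group_closedM HG).
  by apply: HA; left.
by apply: HA; right; exists s.
Qed.

Definition frame_weyl (s : [subg perm_partition p]) : weyl_group V :=
  weyl_class (NormalizerElt (frame_perm_normalizer s)).

Lemma frame_weylM : {morph frame_weyl : s t / (s * t)%g}.
Proof.
move=> s t; rewrite /frame_weyl -[RHS]weyl_classM; congr weyl_class.
by apply/val_inj; rewrite /= frame_permM.
Qed.

HB.instance Definition _ :=
  isMultiplicative.Build [subg perm_partition p] (weyl_group V) frame_weyl
    frame_weylM.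

Lemma frame_weyl_bij : bijective frame_weyl.
Proof.
have inj : injective frame_weyl.
  (* Equality of the classes says that [frame_perm s] induces [t]; it also induces [s]. *)
  move=> s t /weylE /= /borel_frame_perm st; apply/subg_inj/permP => j.
  by apply: (flag_inj (V := V)); rewrite -st frame_perm_image.
have /choice[f fP] w : exists s, frame_weyl s = w.
  have [x ->] := weyl_class_surj w.
  have [s /borel_frame_perm sx] := normalizer_perm (normalizer_valP x).
  by exists s; apply/esym/weylE.
by exists f => // s; apply: inj; rewrite fP.
Qed.

Lemma frame_weyl_involution : (exists w : weyl_group V, w <> 1%g) ->
  exists w : weyl_group V, w <> 1%g /\ (w ^+ 2)%g = 1%g.
Proof.
have [f fK Kf] := frame_weyl_bij; case=> w w1.
have f1 : frame_weyl 1%g = 1%g.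
  by apply: (mulgI (frame_weyl 1%g)); rewrite -frame_weylM !mulg1.
have [|t [t1 tt]] := @perm_partition_involution _ _ (f w).
  by apply/eqP=> fw1; apply: w1; rewrite -(Kf w) fw1.
exists (frame_weyl t); split; last by rewrite expgS expg1 -frame_weylM -f1 -tt.
by rewrite -f1 => /(can_inj fK); apply/eqP.
Qed.

End FlagFrame.

Theorem proposition3p10 (R : realType) (N r : nat) (V : partial_flag R N r)
    (p : 'I_r -> nat) (hp : forall j, \dim (V j) = p j)
    (e : forall j : 'I_r, (p j).-tuple 'rV[R]_N)
    (he : forall j, orthonormal_basis (V j) (e j))
    (q : nat) (n : q.-tuple nat) (hn_uniq : uniq n)
    (hn : forall m, m \in n <-> exists j, p j = m) :
  exists gperm : [subg perm_partition p] -> orthogonal_group R N,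
  [/\ forall (s : [subg perm_partition p]) (j : 'I_r) (i : nat), (i < p j)%N ->
        (e j)`_i *m gperm s = (e (sgval s j))`_i,
      [/\ forall g, g \in flag_borel V -> g \in flag_normalizer V,
          forall s, gperm s \in flag_normalizer V &
          \big[dprod/1%g]_(k < q) Sym (phi p (tnth n k)) = perm_partition p],
      forall g, g \in flag_normalizer V <->
        generated_by (fun x => x \in flag_borel V \/ exists s, x = gperm s) g,
      exists2 f : {multiplicative [subg perm_partition p] -> weyl_group V},
        bijective f &
        forall s (x : normalizer_group V),
          normalizer_val x = gperm s -> f s = weyl_class x &
      [/\ ([set: weyl_group V]%classic #= `I_(\prod_(k < q) (psi p (tnth n k))`!))%card,
          (\prod_(k < q) (psi p (tnth n k))`! =
             \prod_(1 <= m < N.+1) (psi p m)`!)%N &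
          (exists w : weyl_group V, w <> 1%g) ->
            exists w : weyl_group V, w <> 1%g /\ (w ^+ 2)%g = 1%g]].
Proof.
exists (frame_perm he); split.
- exact: frame_permE.
- split; [exact: flag_borel_normalizer | exact: frame_perm_normalizer |].
  exact: perm_partition_dprod.
- exact: normalizer_generated.
- exists (frame_weyl he : {multiplicative _ -> _}); first exact: frame_weyl_bij.
  by move=> s x xs; congr weyl_class; apply/val_inj.
split; last exact: (frame_weyl_involution he).
  (* The isomorphism [isog_subg] passes from the cardinal of a set of permutations to that of the
     type [[subg perm_partition p]], the domain of the bijection. *)
  rewrite -(card_perm_partition hn_uniq hn) (card_isog (isog_subg (perm_partition_group p))) cardsT.
  exact: card_eq_fintype (frame_weyl_bij he).
(* The bounds 0 < [p j] <= [N] hold because [V j] is a nonzero subspace of an [N]-dimensional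
   space. *)
apply: prod_psi_fact => // j; rewrite -hp lt0n dimv_eq0 flag_neq0 /=.
by rewrite (leq_trans (dimvS (subvf _))) // dimvf /dim /= mul1n.
Qed.
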